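(* If $\Gamma\cup\Delta\subseteq\forall_1$ and there exists an $\alpha$-flow from $\Gamma$ to $\Delta$ (i.e. from $\bigwedge\Gamma$ to $\bigvee\Delta$), then $\mathrm{TI}(\forall_1,\prec)\vdash\Gamma\Rightarrow\Delta$.
   Context: **Setting.** $\mathrm{PV}$ is Cook's theory of polynomial time functions, as a universal first-order theory in the language $\mathcal{L}_{\mathrm{PV}}$. $\alpha$ is an ordinal with a $\mathrm{PV}$-representation $\prec$ of its order and of its ordinal arithmetic: $\prec$ is a quantifier-free relation of $\mathcal{L}_{\mathrm{PV}}$ of order type $\alpha$, and there are $\mathcal{L}_{\mathrm{PV}}$-terms $+,\cdot,-,\lfloor\frac{\cdot}{\cdot}\rfloor$ and constants $0,1$ for ordinal arithmetic such that $\mathrm{PV}$ proves the axioms of discrete ordered semirings for them, except commutativity of addition, together with the axioms that $\prec$ is preserved under left addition and under left multiplication by a non-zero element. Greek letters $\beta,\gamma,\delta$ range over (codes of) ordinals; $\preceq$, $\gamma+1$, etc. refer to this representation. $\forall_1$ is the class of universal formulas of $\mathcal{L}_{\mathrm{PV}}$ (conjunctions and disjunctions of such formulas being identified with equivalent universal formulas). **The system $\mathrm{TI}(\forall_1,\prec)$.** The usual first-order sequent calculus in $\mathcal{L}_{\mathrm{PV}}$ plus the axioms of $\mathrm{PV}$ and the induction rule: from $\Gamma,\forall\gamma\prec\beta\,A(\gamma)\Rightarrow\Delta,A(\beta)$ infer $\Gamma\Rightarrow\Delta,A(\delta)$, for every $A\in\forall_1$ ($\beta$ an eigenvariable, $\delta$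 a term). **$\alpha$-flow.** For $A(\vec x),B(\vec x)\in\forall_1$, an $\alpha$-flow from $A$ to $B$ (written $A\rhd B$) is a pair $(H,\beta)$, with $H(\delta,\vec x)\in\forall_1$ a formula and $\beta$ a term for an ordinal, such that: (i) $\mathrm{PV}\vdash A(\vec x)\to\forall\gamma\prec1\;H(\gamma,\vec x)$; (ii) $\mathrm{PV}\vdash\forall\gamma\prec\beta\,[\forall\delta\prec\gamma\,H(\delta,\vec x)\to\forall\delta\prec\gamma+1\,H(\delta,\vec x)]$; (iii) $\mathrm{PV}\vdash(\forall\gamma\prec\beta\,H(\gamma,\vec x))\to B(\vec x)$. *)

(* Defs.v *)
From Stdlib Require List.
From mathcomp Require Import all_boot.
Set Implicit Arguments.
Unset Strict Implicit.
Unset Printing Implicit Defensive.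

(* Argument vectors of length k are functions on 'I_k. *)
Definition fnil (T : Type) : 'I_0 -> T.
Proof. by case. Defined.

Definition fcons (T : Type) k (x : T) (a : 'I_k -> T) : 'I_k.+1 -> T :=
  fun i => if unlift ord0 i is Some j then a j else x.

Definition ftail (T : Type) k (a : 'I_k.+1 -> T) : 'I_k -> T :=
  fun i => a (lift ord0 i).

(** * First-order syntax over a signature, with de Bruijn variables *)

Inductive term (F : nat -> Type) : Type :=
| Var (i : nat)
| App k (f : F k) (a : 'I_k -> term F).
Arguments Var {F} i.

Inductive form (F : nat -> Type) : Type :=
| Eq (t u : term F)
| Bot
| And (A B : form F)
| Or (A B : form F)
| Imp (A B : form F)
| All (A : form F)
| Ex (A : form F).
Arguments Bot {F}.

Definition Neg F (A : form F) : form F := Imp A Bot.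
Definition bigAnd F (s : seq (form F)) : form F := foldr (@And F) (Neg Bot) s.
Definition bigOr F (s : seq (form F)) : form F := foldr (@Or F) Bot s.

Definition scons F (t : term F) (s : nat -> term F) : nat -> term F :=
  fun i => if i is j.+1 then s j else t.

Fixpoint tsubst F (s : nat -> term F) (t : term F) : term F :=
  match t with
  | Var i => s i
  | App _ f a => App f (fun j => tsubst s (a j))
  end.

Definition tshift F : term F -> term F := tsubst (fun i => Var i.+1).

Definition up F (s : nat -> term F) : nat -> term F :=
  scons (Var 0) (fun i => tshift (s i)).

Fixpoint subst F (s : nat -> term F) (A : form F) : form F :=
  match A with
  | Eq t u => Eq (tsubst s t) (tsubst s u)
  | Bot => Bot
  | And A B => And (subst s A) (subst s B)
  | Or A B => Or (subst s A) (subst s B)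
  | Imp A B => Imp (subst s A) (subst s B)
  | All A => All (subst (up s) A)
  | Ex A => Ex (subst (up s) A)
  end.

Definition shift F : form F -> form F := subst (fun i => Var i.+1).

(* Shifts every free variable except variable 0. *)
Definition shift1 F : form F -> form F := subst (up (fun i => Var i.+1)).

Definition inst F (A : form F) (t : term F) : form F := subst (scons t Var) A.

(* The free variables are among 0, ..., n-1. *)
Fixpoint tbelow F (n : nat) (t : term F) : Prop :=
  match t with
  | Var i => i < n
  | App _ _ a => forall j, tbelow n (a j)
  end.

Fixpoint fbelow F (n : nat) (A : form F) : Prop :=
  match A with
  | Eq t u => tbelow n t /\ tbelow n u
  | Bot => True
  | And A B | Or A B | Imp A B => fbelow n A /\ fbelow n B
  | All A | Ex A => fbelow n.+1 A
  end.

(* Substitution into terms and formulas with (at most) two free variables. *)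
Definition tapp2 F (p s t : term F) : term F := tsubst (scons s (scons t Var)) p.
Definition fapp2 F (P : form F) (s t : term F) : form F :=
  subst (scons s (scons t Var)) P.

Fixpoint qf F (A : form F) : Prop :=
  match A with
  | Eq _ _ | Bot => True
  | And A B | Or A B | Imp A B => qf A /\ qf B
  | All _ | Ex _ => False
  end.

(* Universal formulas; conjunctions and disjunctions of universal formulas
   count as universal without being put in prenex form. *)
Inductive forall1 F : form F -> Prop :=
| forall1_qf A : qf A -> forall1 A
| forall1_and A B : forall1 A -> forall1 B -> forall1 (And A B)
| forall1_or A B : forall1 A -> forall1 B -> forall1 (Or A B)
| forall1_all A : forall1 A -> forall1 (All A).

(** * Function symbols and equational theory of Cook's PV

   As in Cook (1975), numbers are written in dyadic notation: Succ false and
   Succ true are the successors s_1(x) = 2x+1 and s_2(x) = 2x+2, and Trunc,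
   Cat, Smash, Less are Cook's TR, *, (x), LESS, where LESS(x,y) = 0 expresses
   |x| <= |y|. Explicit definitions are generated by projections and
   compositions. [Rec g h b] is recursion on notation with bounds b; it is a
   symbol of PV only if PV proves the bounds, see [pvdef] below. *)

Inductive sym : nat -> Type :=
| Zero : sym 0
| Succ (d : bool) : sym 1
| Trunc : sym 1
| Cat : sym 2
| Smash : sym 2
| Less : sym 2
| Proj k (i : 'I_k) : sym k
| Comp k m (f : sym m) (g : 'I_m -> sym k) : sym k
| Rec k (g : sym k) (h : bool -> sym k.+2) (b : bool -> sym k.+1) : sym k.+1.

Notation rterm := (term sym).

Definition app0 F (f : F 0) : term F := App f (@fnil _).
Definition app1 F (f : F 1) (t : term F) : term F := App f (fcons t (@fnil _)).
Definition app2 F (f : F 2) (t u : term F) : term F :=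
  App f (fcons t (fcons u (@fnil _))).

Definition args k : 'I_k -> rterm := fun i => Var i.
Local Notation x_ := (Var 0 : rterm).
Local Notation z_ := (Var 1 : rterm).
Local Notation y_ := (fun i => Var i.+2 : rterm).

Inductive pvdef : forall k, sym k -> Prop :=
| pvdef_zero : pvdef Zero
| pvdef_succ d : pvdef (Succ d)
| pvdef_trunc : pvdef Trunc
| pvdef_cat : pvdef Cat
| pvdef_smash : pvdef Smash
| pvdef_less : pvdef Less
| pvdef_proj k (i : 'I_k) : pvdef (Proj i)
| pvdef_comp k m (f : sym m) (g : 'I_m -> sym k) :
    pvdef f -> (forall i, pvdef (g i)) -> pvdef (Comp f g)
| pvdef_rec k (g : sym k) (h : bool -> sym k.+2) (b : bool -> sym k.+1) :
    pvdef g -> (forall d, pvdef (h d)) -> (forall d, pvdef (b d)) ->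
    (forall d, pveq (app2 Less (App (h d) (fcons z_ (fcons x_ y_)))
                               (app2 Cat z_ (App (b d) (fcons x_ y_))))
                    (app0 Zero)) ->
    pvdef (Rec g h b)

with pvterm : rterm -> Prop :=
| pvterm_var i : pvterm (Var i)
| pvterm_app k (f : sym k) (a : 'I_k -> rterm) :
    pvdef f -> (forall i, pvterm (a i)) -> pvterm (App f a)

with pveq : rterm -> rterm -> Prop :=
| pveq_trunc0 : pveq (app1 Trunc (app0 Zero)) (app0 Zero)
| pveq_truncS d : pveq (app1 Trunc (app1 (Succ d) x_)) x_
| pveq_cat0 : pveq (app2 Cat x_ (app0 Zero)) x_
| pveq_catS d : pveq (app2 Cat x_ (app1 (Succ d) z_))
                     (app1 (Succ d) (app2 Cat x_ z_))
| pveq_smash0 : pveq (app2 Smash x_ (app0 Zero)) (app0 Zero)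
| pveq_smashS d : pveq (app2 Smash x_ (app1 (Succ d) z_))
                       (app2 Cat (app2 Smash x_ z_) x_)
| pveq_less0 : pveq (app2 Less x_ (app0 Zero)) x_
| pveq_lessS d : pveq (app2 Less x_ (app1 (Succ d) z_))
                      (app1 Trunc (app2 Less x_ z_))
| pveq_proj k (i : 'I_k) : pveq (App (Proj i) (@args k)) (Var i)
| pveq_comp k m (f : sym m) (g : 'I_m -> sym k) :
    pvdef (Comp f g) ->
    pveq (App (Comp f g) (@args k)) (App f (fun j => App (g j) (@args k)))
| pveq_rec0 k (g : sym k) (h : bool -> sym k.+2) (b : bool -> sym k.+1) :
    pvdef (Rec g h b) ->
    pveq (App (Rec g h b) (fcons (app0 Zero) y_)) (App g y_)
| pveq_recS k (g : sym k) (h : bool -> sym k.+2) (b : bool -> sym k.+1) d :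
    pvdef (Rec g h b) ->
    pveq (App (Rec g h b) (fcons (app1 (Succ d) x_) y_))
         (App (h d) (fcons (App (Rec g h b) (fcons x_ y_)) (fcons x_ y_)))
| pveq_sym t u : pveq t u -> pveq u t
| pveq_trans t u v : pveq t u -> pveq u v -> pveq t v
| pveq_congr k (f : sym k) (a b : 'I_k -> rterm) :
    pvdef f -> (forall i, pveq (a i) (b i)) -> pveq (App f a) (App f b)
| pveq_subst (s : nat -> rterm) t u :
    (forall i, pvterm (s i)) -> pveq t u -> pveq (tsubst s t) (tsubst s u)
| pveq_notation_ind k (f : bool -> sym k.+1) (g : sym k) (h : bool -> sym k.+2) :
    (forall e, pvdef (f e)) -> pvdef g -> (forall d, pvdef (h d)) ->
    (forall e, pveq (App (f e) (fcons (app0 Zero) y_)) (App g y_)) ->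
    (forall e d, pveq (App (f e) (fcons (app1 (Succ d) x_) y_))
                      (App (h d) (fcons (App (f e) (fcons x_ y_))
                                        (fcons x_ y_)))) ->
    pveq (App (f false) (fcons x_ y_)) (App (f true) (fcons x_ y_)).

(** * The language L_PV and the universal first-order theory PV *)

Definition pvsym (k : nat) : Type := {f : sym k | pvdef f}.

Notation tm := (term pvsym).
Notation fm := (form pvsym).

Fixpoint raw (t : tm) : rterm :=
  match t with
  | Var i => Var i
  | App _ f a => App (sval f) (fun j => raw (a j))
  end.

Definition pv0 : tm := @app0 pvsym (exist _ Zero pvdef_zero).
Definition pvS (d : bool) (t : tm) : tm :=
  @app1 pvsym (exist _ (Succ d) (pvdef_succ d)) t.

Fixpoint truth F (v : term F -> term F -> bool) (A : form F) : bool :=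
  match A with
  | Eq t u => v t u
  | And A B => truth v A && truth v B
  | Or A B => truth v A || truth v B
  | Imp A B => truth v A ==> truth v B
  | Bot | All _ | Ex _ => false
  end.

(* The nonlogical axioms of PV as a first-order theory: the quantifier-free
   theorems of Cook's system PV1, i.e. the closure of the equations of PV and
   of 0 <> s_1(0) under propositional logic with equality, substitution and
   induction on notation. They are read as their universal closures. *)
Inductive pvax : fm -> Prop :=
| pvax_eqn t u : pveq (raw t) (raw u) -> pvax (Eq t u)
| pvax_neq : pvax (Neg (Eq pv0 (pvS false pv0)))
| pvax_refl t : pvax (Eq t t)
| pvax_leibniz A t u :
    qf A -> pvax (Imp (Eq t u) (Imp (inst A t) (inst A u)))
| pvax_taut A : qf A -> (forall v, truth v A) -> pvax A
| pvax_mp A B : pvax (Imp A B) -> pvax A -> pvax B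
| pvax_subst A (s : nat -> tm) : pvax A -> pvax (subst s A)
| pvax_notation_ind A :
    pvax (inst A pv0) ->
    (forall d, pvax (Imp A (subst (scons (pvS d (Var 0)) (fun i => Var i.+1)) A))) ->
    pvax A.

(** * Sequent calculus with additional rules [R premises conclusion] *)

Definition sequent : Type := seq fm * seq fm.

Reserved Notation "G ===> D" (at level 70, no associativity).

Inductive LK (R : seq sequent -> sequent -> Prop) : sequent -> Prop :=
| LK_rule ps c : R ps c -> (forall p, List.In p ps -> LK R p) -> LK R c
| LK_id A : LK R ([:: A], [:: A])
| LK_bot : LK R ([:: Bot], [::])
| LK_eq_refl t : LK R ([::], [:: Eq t t])
| LK_eq_subst A t u : LK R ([:: Eq t u; inst A t], [:: inst A u])
(* weakening, contraction and exchange *)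
| LK_struct G D G' D' :
    List.incl G G' -> List.incl D D' -> LK R (G, D) -> LK R (G', D')
| LK_cut A G D : LK R (G, A :: D) -> LK R (A :: G, D) -> LK R (G, D)
| LK_andL A B G D : LK R ([:: A, B & G], D) -> LK R (And A B :: G, D)
| LK_andR A B G D :
    LK R (G, A :: D) -> LK R (G, B :: D) -> LK R (G, And A B :: D)
| LK_orL A B G D :
    LK R (A :: G, D) -> LK R (B :: G, D) -> LK R (Or A B :: G, D)
| LK_orR A B G D : LK R (G, [:: A, B & D]) -> LK R (G, Or A B :: D)
| LK_impL A B G D :
    LK R (G, A :: D) -> LK R (B :: G, D) -> LK R (Imp A B :: G, D)
| LK_impR A B G D : LK R (A :: G, B :: D) -> LK R (G, Imp A B :: D)
| LK_allL A t G D : LK R (inst A t :: G, D) -> LK R (All A :: G, D)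
| LK_allR A G D :
    LK R (map (@shift _) G, A :: map (@shift _) D) -> LK R (G, All A :: D)
| LK_exL A G D :
    LK R (A :: map (@shift _) G, map (@shift _) D) -> LK R (Ex A :: G, D)
| LK_exR A t G D : LK R (G, inst A t :: D) -> LK R (G, Ex A :: D).

Inductive PV_rule : seq sequent -> sequent -> Prop :=
| PV_axiom A : pvax A -> PV_rule [::] ([::], [:: A]).

Definition PV (A : fm) : Prop := LK PV_rule ([::], [:: A]).

(** * Standard model and ordinals *)

(* The standard model consists of the dyadic numerals, least significant digit
   first, with digits false = 1 and true = 2; [::] is the number 0. *)
Fixpoint sym_eval k (f : sym k) : ('I_k -> bitseq) -> bitseq :=
  match f in sym k return ('I_k -> bitseq) -> bitseq with
  | Zero => fun _ => [::]
  | Succ d => fun a => d :: a ord0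
  | Trunc => fun a => behead (a ord0)
  | Cat => fun a => a ord_max ++ a ord0
  | Smash => fun a => flatten (nseq (size (a ord_max)) (a ord0))
  | Less => fun a => drop (size (a ord_max)) (a ord0)
  | Proj _ i => fun a => a i
  | Comp _ _ f g => fun a => sym_eval f (fun j => sym_eval (g j) a)
  | Rec _ g h _ => fun a =>
      (fix rec (x : bitseq) : bitseq :=
         if x is d :: x'
         then sym_eval (h d) (fcons (rec x') (fcons x' (ftail a)))
         else sym_eval g (ftail a)) (a ord0)
  end.

Fixpoint tm_eval (e : nat -> bitseq) (t : tm) : bitseq :=
  match t with
  | Var i => e i
  | App _ f a => sym_eval (sval f) (fun j => tm_eval e (a j))
  end.

Fixpoint sat (e : nat -> bitseq) (A : fm) : Prop :=
  match A with
  | Eq t u => tm_eval e t = tm_eval e u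
  | Bot => False
  | And A B => sat e A /\ sat e B
  | Or A B => sat e A \/ sat e B
  | Imp A B => sat e A -> sat e B
  | All A => forall x, sat (fun i => if i is j.+1 then e j else x) A
  | Ex A => exists x, sat (fun i => if i is j.+1 then e j else x) A
  end.

(* Ordinals, given as (representatives of the order type of) well-orders. *)
Record ordinal_type : Type := OrdinalType {
  ord_car :> Type;
  ord_lt : ord_car -> ord_car -> Prop;
  ord_wf : well_founded ord_lt;
  ord_trans : forall x y z, ord_lt x y -> ord_lt y z -> ord_lt x z;
  ord_total : forall x y, ord_lt x y \/ x = y \/ ord_lt y x
}.

(* The relation defined by P in the standard model has order type alpha. *)
Definition has_order_type (P : fm) (alpha : ordinal_type) : Prop :=
  exists2 f : bitseq -> alpha, bijective f &
    forall (x y : bitseq),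
      sat (fun i => nth [::] [:: x; y] i) P <-> ord_lt (f x) (f y).

(* An order formula in the variables 0 and 1, and terms for the ordinal
   operations in the same variables. *)
Record ordinal_code : Type := OrdinalCode {
  c_lt : fm;
  c_add : tm;
  c_mul : tm;
  c_sub : tm;
  c_quo : tm;
  c_zero : tm;
  c_one : tm
}.

Definition olt (c : ordinal_code) (s t : tm) : fm := fapp2 (c_lt c) s t.
Definition ole (c : ordinal_code) (s t : tm) : fm := Or (olt c s t) (Eq s t).
Definition oadd (c : ordinal_code) (s t : tm) : tm := tapp2 (c_add c) s t.
Definition omul (c : ordinal_code) (s t : tm) : tm := tapp2 (c_mul c) s t.
Definition osub (c : ordinal_code) (s t : tm) : tm := tapp2 (c_sub c) s t.
Definition oquo (c : ordinal_code) (s t : tm) : tm := tapp2 (c_quo c) s t.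

(* Bounded quantifier: variable 0 is bound in A, and ranges below b. *)
Definition ball (c : ordinal_code) (b : tm) (A : fm) : fm :=
  All (Imp (olt c (Var 0) (tshift b)) A).

Local Notation x := (Var 0 : tm).
Local Notation y := (Var 1 : tm).
Local Notation z := (Var 2 : tm).

(* PV-representations of alpha. As for ordinals, addition is not commutative,
   multiplication distributes over addition on the left only, and strict
   monotonicity is required on the left only. The axioms for subtraction and
   division are their defining properties in ordinal arithmetic; together with
   the other axioms they make the interpretations of the terms in the standard
   model coincide with the ordinal operations of alpha. *)
Record PV_representation (alpha : ordinal_type) (c : ordinal_code) : Prop := {
  r_lt_qf : qf (c_lt c);
  r_lt_below : fbelow 2 (c_lt c);
  r_add_below : tbelow 2 (c_add c);
  r_mul_below : tbelow 2 (c_mul c);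
  r_sub_below : tbelow 2 (c_sub c);
  r_quo_below : tbelow 2 (c_quo c);
  r_zero_below : tbelow 0 (c_zero c);
  r_one_below : tbelow 0 (c_one c);
  r_order_type : has_order_type (c_lt c) alpha;
  r_lt_irr : PV (Neg (olt c x x));
  r_lt_trans : PV (Imp (olt c x y) (Imp (olt c y z) (olt c x z)));
  r_lt_total : PV (Or (olt c x y) (Or (Eq x y) (olt c y x)));
  r_ge0 : PV (ole c (c_zero c) x);
  r_lt01 : PV (olt c (c_zero c) (c_one c));
  r_discrete : PV (Imp (olt c (c_zero c) x) (ole c (c_one c) x));
  r_addA : PV (Eq (oadd c x (oadd c y z)) (oadd c (oadd c x y) z));
  r_add0x : PV (Eq (oadd c (c_zero c) x) x);
  r_addx0 : PV (Eq (oadd c x (c_zero c)) x);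
  r_mulA : PV (Eq (omul c x (omul c y z)) (omul c (omul c x y) z));
  r_mul1x : PV (Eq (omul c (c_one c) x) x);
  r_mulx1 : PV (Eq (omul c x (c_one c)) x);
  r_mul0x : PV (Eq (omul c (c_zero c) x) (c_zero c));
  r_mulx0 : PV (Eq (omul c x (c_zero c)) (c_zero c));
  r_mulDr :
    PV (Eq (omul c x (oadd c y z)) (oadd c (omul c x y) (omul c x z)));
  r_lt_add2l : PV (Imp (olt c x y) (olt c (oadd c z x) (oadd c z y)));
  r_lt_mul2l : PV (Imp (Neg (Eq z (c_zero c)))
                       (Imp (olt c x y) (olt c (omul c z x) (omul c z y))));
  r_subP : PV (Imp (ole c y x) (Eq (oadd c y (osub c x y)) x));
  r_quoP : PV (Imp (Neg (Eq y (c_zero c)))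
                   (And (ole c (omul c y (oquo c x y)) x)
                        (olt c x (omul c y (oadd c (oquo c x y) (c_one c))))))
}.

(** * Transfinite induction and flows *)

(* In A, variable 0 is the induction variable. In the premise of the induction
   rule, the eigenvariable is variable 0 and the context is shifted. *)
Inductive TI_rule (c : ordinal_code) : seq sequent -> sequent -> Prop :=
| TI_axiom A : pvax A -> TI_rule c [::] ([::], [:: A])
| TI_ind A t G D :
    forall1 A ->
    TI_rule c
      [:: (ball c (Var 0) (shift1 A) :: map (@shift _) G,
           A :: map (@shift _) D)]
      (G, inst A t :: D).

Definition TI (c : ordinal_code) : sequent -> Prop := LK (TI_rule c).

(* In H, variable 0 is the ordinal variable; the other variables of H, and the
   variables of A, B and b, are the parameters. *)
Record alpha_flow (c : ordinal_code) (A B H : fm) (b : tm) : Prop := {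
  flow_A : forall1 A;
  flow_B : forall1 B;
  flow_H : forall1 H;
  flow_start : PV (Imp A (ball c (c_one c) H));
  flow_step :
    PV (ball c b (Imp (ball c (Var 0) (shift1 H))
                      (ball c (oadd c (Var 0) (c_one c)) (shift1 H))));
  flow_end : PV (Imp (ball c b H) B)
}.

(* Main.v *)
Require Import Defs.
From Stdlib Require List.
From mathcomp Require Import all_boot.
From Stdlib Require Import FunctionalExtensionality.

(** The formula [gamma < beta -> H gamma], written as a disjunction to be
    universal, is progressive: if it holds below [gamma], and [gamma < beta],
    then [H] holds below [gamma] by transitivity of the order, hence below
    [gamma + 1] by the step of the flow, and [gamma < gamma + 1]. Transfinite
    induction thus gives [H] below [beta], and the end of the flow applies. *)

(** * Substitution calculus for de Bruijn terms and formulas *)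

Lemma tsubst_ext_below F n s s' (t : term F) :
  (forall i, i < n -> s i = s' i) -> tbelow n t -> tsubst s t = tsubst s' t.
Proof.
move=> ss'; elim: t => [i|k f a IHa] /= below_t; first exact: ss'.
by congr App; apply: functional_extensionality => j; apply: IHa.
Qed.

Lemma up_ext_below F n (s s' : nat -> term F) :
  (forall i, i < n -> s i = s' i) -> forall i, i < n.+1 -> up s i = up s' i.
Proof. by move=> ss' [|i] //= lt_in; rewrite ss'. Qed.

(** Used for the order formula, whose free variables are 0 and 1 only: checking these two indices
    suffices to move a substitution through [olt]. *)
Lemma subst_ext_below F (A : form F) n s s' :
  (forall i, i < n -> s i = s' i) -> fbelow n A -> subst s A = subst s' A.
Proof.
elim: A n s s' => /=
  [t u|//|A IHA B IHB|A IHA B IHB|A IHA B IHB|A IHA|A IHA] n s s' ss'.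
- by case=> *; congr Eq; apply: tsubst_ext_below ss' _.
- by case=> *; congr And; [apply: IHA ss' _ | apply: IHB ss' _].
- by case=> *; congr Or; [apply: IHA ss' _ | apply: IHB ss' _].
- by case=> *; congr Imp; [apply: IHA ss' _ | apply: IHB ss' _].
- by move=> below_A; congr All; apply: IHA below_A; apply: up_ext_below.
- by move=> below_A; congr Ex; apply: IHA below_A; apply: up_ext_below.
Qed.

Lemma tsubst_comp F s s' (t : term F) :
  tsubst s (tsubst s' t) = tsubst (fun i => tsubst s (s' i)) t.
Proof.
elim: t => [//|k f a IHa] /=.
by congr App; apply: functional_extensionality => j; apply: IHa.
Qed.

Lemma tsubst_Var F (t : term F) : tsubst Var t = t.
Proof.
elim: t => [//|k f a IHa] /=.
by congr App; apply: functional_extensionality => j; apply: IHa.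
Qed.

Lemma tsubst_up_tshift F s (t : term F) :
  tsubst (up s) (tshift t) = tshift (tsubst s t).
Proof. by rewrite /tshift !tsubst_comp. Qed.

Lemma up_Var F : up (@Var F) = Var.
Proof. by apply: functional_extensionality => -[]. Qed.

Lemma up_comp F (s s' : nat -> term F) :
  (fun i => tsubst (up s) (up s' i)) = up (fun i => tsubst s (s' i)).
Proof.
by apply: functional_extensionality => -[|i] //=; rewrite tsubst_up_tshift.
Qed.

Lemma subst_comp F s s' (A : form F) :
  subst s (subst s' A) = subst (fun i => tsubst s (s' i)) A.
Proof.
elim: A s s' => //= [t u|A IHA B IHB|A IHA B IHB|A IHA B IHB|A IHA|A IHA] s s';
  by rewrite ?tsubst_comp ?IHA ?IHB ?up_comp.
Qed.

Lemma subst_Var F (A : form F) : subst Var A = A.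
Proof.
elim: A => //= [t u|A IHA B IHB|A IHA B IHB|A IHA B IHB|A IHA|A IHA];
  by rewrite ?tsubst_Var ?up_Var ?IHA ?IHB.
Qed.

Lemma subst_up_shift F s (A : form F) :
  subst (up s) (shift A) = shift (subst s A).
Proof. by rewrite /shift !subst_comp. Qed.

Lemma subst_inst F s (A : form F) t :
  subst s (inst A t) = inst (subst (up s) A) (tsubst s t).
Proof.
rewrite /inst !subst_comp; congr subst.
apply: functional_extensionality => -[|i] //=.
by rewrite /tshift tsubst_comp /= tsubst_Var.
Qed.

(** [shift1] raises the parameters by one and [inst] lowers them again, so the composite
    substitution is the identity. This exhibits any formula as an instance at its own variable 0. *)
Lemma inst_shift1 F (A : form F) : inst (shift1 A) (Var 0) = A.
Proof.
rewrite /inst /shift1 subst_comp -[RHS]subst_Var; congr subst.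
by apply: functional_extensionality => -[].
Qed.

Lemma subst_up_shift1 F s (A : form F) :
  subst (up (up s)) (shift1 A) = shift1 (subst (up s) A).
Proof.
rewrite /shift1 !subst_comp; congr subst.
apply: functional_extensionality => -[|i] //=.
by rewrite /tshift !tsubst_comp.
Qed.

(** * Derived rules of the sequent calculus *)

Section Derivations.

Variable R : seq sequent -> sequent -> Prop.

Lemma LK_In A G D : List.In A G -> List.In A D -> LK R (G, D).
Proof. by move=> inG inD; apply: LK_struct (LK_id _ A) => B [<-|[]]. Qed.

Lemma LK_theorem A G : LK R ([::], [:: A]) -> LK R (G, [:: A]).
Proof. by apply: LK_struct => // B. Qed.

Lemma LK_cut1 A B G :
  LK R (G, [:: A]) -> LK R (A :: G, [:: B]) -> LK R (G, [:: B]).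
Proof.
by move=> dA; apply: LK_cut; apply: LK_struct dA => // C [<-|[]]; left.
Qed.

Lemma LK_mp A B G :
  LK R (G, [:: Imp A B]) -> LK R (G, [:: A]) -> LK R (G, [:: B]).
Proof.
move=> dAB dA; apply: LK_cut1 dAB _; apply: LK_impL.
  by apply: LK_struct dA => // C [<-|[]]; left.
by apply: (@LK_In B); left.
Qed.

Lemma LK_inst A t G : LK R (G, [:: All A]) -> LK R (G, [:: inst A t]).
Proof.
move=> dA; apply: LK_cut1 dA _; apply: (LK_allL (t := t)).
by apply: (@LK_In (inst A t)); left.
Qed.

(** For a universal hypothesis that an eigenvariable rule has shifted: instantiating it at the new
    variable 0 recovers its matrix. *)
Lemma LK_shift_allE A G : List.In (shift (All A)) G -> LK R (G, [:: A]).
Proof.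
move=> inG; rewrite -[A in LK R (_, [:: A])]inst_shift1; apply: LK_inst.
by apply: (@LK_In (shift (All A))); last by left.
Qed.

(** Modus ponens for the disjunctive form of implication; [forall1] accepts [Imp] only between
    quantifier-free formulas. *)
Lemma LK_orNE A B G :
  LK R (G, [:: Or (Neg A) B]) -> LK R (G, [:: A]) -> LK R (G, [:: B]).
Proof.
move=> dAB dA; apply: LK_cut1 dAB _; apply: LK_orL.
  apply: LK_impL; first by apply: LK_struct dA => // C [<-|[]]; left.
  by apply: LK_struct (LK_bot _) => // C [<-|[]]; left.
by apply: (@LK_In B); left.
Qed.

Lemma LK_orNI A B G : LK R (A :: G, [:: B]) -> LK R (G, [:: Or (Neg A) B]).
Proof.
move=> dB; apply: LK_orR; apply: LK_impR.
by apply: LK_struct dB => // C [<-|[]]; right; left.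
Qed.

Lemma LK_bigOrL D : LK R ([:: bigOr D], D).
Proof.
elim: D => [|A D IHD] /=; first exact: LK_bot.
apply: LK_orL; first by apply: (@LK_In A); left.
by apply: LK_struct IHD => // C; right.
Qed.

Lemma LK_sub (R' : seq sequent -> sequent -> Prop) S :
  (forall ps q, R ps q -> R' ps q) -> LK R S -> LK R' S.
Proof.
move=> RR'; elim=> {S}; try by econstructor; eauto.
Qed.

End Derivations.

(** By induction on the derivation, for all [s] at once since the eigenvariable rules call the
    hypothesis at [up s]. The axioms are closed under substitution by [pvax_subst]. *)
Lemma LK_PV_subst S s :
  LK PV_rule S -> LK PV_rule (map (subst s) S.1, map (subst s) S.2).
Proof.
have map_shift s' (G : seq fm) :
    map (subst (up s')) (map (@shift _) G) = map (@shift _) (map (subst s') G).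
  by rewrite -!map_comp; apply: eq_map => A; apply: subst_up_shift.
have incl_map s' (G G' : seq fm) :
    List.incl G G' -> List.incl (map (subst s') G) (map (subst s') G').
  by move=> GG' A /List.in_map_iff[B [<- /GG']]; apply: List.in_map.
move=> dS; elim: dS s => {S} /=.
- move=> ps q [A axA] _ _ s /=.
  by apply: (LK_rule (PV_axiom (pvax_subst s axA))).
- by move=> A s; apply: LK_id.
- by move=> s; apply: LK_bot.
- by move=> t s; apply: LK_eq_refl.
- by move=> A t u s; rewrite !subst_inst; apply: LK_eq_subst.
- move=> G D G' D' GG' DD' _ IH s.
  by apply: LK_struct (IH s); apply: incl_map.
- by move=> A G D _ IH1 _ IH2 s; apply: LK_cut (IH1 s) (IH2 s).
- by move=> A B G D _ IH s; apply: LK_andL (IH s).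
- by move=> A B G D _ IH1 _ IH2 s; apply: LK_andR (IH1 s) (IH2 s).
- by move=> A B G D _ IH1 _ IH2 s; apply: LK_orL (IH1 s) (IH2 s).
- by move=> A B G D _ IH s; apply: LK_orR (IH s).
- by move=> A B G D _ IH1 _ IH2 s; apply: LK_impL (IH1 s) (IH2 s).
- by move=> A B G D _ IH s; apply: LK_impR (IH s).
- move=> A t G D _ IH s.
  by apply: (LK_allL (t := tsubst s t)); rewrite -subst_inst; apply: IH.
- by move=> A G D _ IH s; apply: LK_allR; rewrite -!map_shift; apply: IH.
- by move=> A G D _ IH s; apply: LK_exL; rewrite -!map_shift; apply: IH.
- move=> A t G D _ IH s.
  by apply: (LK_exR (t := tsubst s t)); rewrite -subst_inst; apply: IH.
Qed.

Lemma PV_subst A s : PV A -> PV (subst s A).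
Proof. exact: LK_PV_subst. Qed.

(** The parameters are shifted up first, because instantiating at [Var 0] lowers them by one. *)
Lemma PV_allE A : PV (All A) -> PV A.
Proof.
move=> /(PV_subst _ (fun i => Var i.+1)) dA.
by rewrite -[A]inst_shift1; apply: LK_inst.
Qed.

(** * Progressiveness of the guarded formula and transfinite induction *)

Section Flow.

Variables (alpha : ordinal_type) (c : ordinal_code).
Hypothesis rep : PV_representation alpha c.

Lemma tsubst_closed s (t : tm) : tbelow 0 t -> tsubst s t = t.
Proof.
by move=> below_t; rewrite -[RHS]tsubst_Var; apply: tsubst_ext_below below_t.
Qed.

Lemma subst_olt s t u : subst s (olt c t u) = olt c (tsubst s t) (tsubst s u).
Proof.
rewrite /olt /fapp2 subst_comp; apply: subst_ext_below (r_lt_below rep).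
by case=> [|[|i]].
Qed.

Lemma tsubst_oadd s t u :
  tsubst s (oadd c t u) = oadd c (tsubst s t) (tsubst s u).
Proof.
rewrite /oadd /tapp2 tsubst_comp; apply: tsubst_ext_below (r_add_below rep).
by case=> [|[|i]].
Qed.

Lemma subst_ball s t A :
  subst s (ball c t A) = ball c (tsubst s t) (subst (up s) A).
Proof. by rewrite /ball /= subst_olt tsubst_up_tshift. Qed.

Lemma PV_lt_trans s t u : PV (Imp (olt c s t) (Imp (olt c t u) (olt c s u))).
Proof.
have := PV_subst _ (scons s (scons t (scons u Var))) (r_lt_trans rep).
by rewrite /= !subst_olt.
Qed.

(** Left monotonicity of addition turns $0 \prec 1$ into $t+0 \prec t+1$, and $t+0 = t$. *)
Lemma PV_lt_succ t : PV (olt c t (oadd c t (c_one c))).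
Proof.
have mono := PV_subst _ (scons (c_zero c) (scons (c_one c) (scons t Var)))
               (r_lt_add2l rep).
have add0 := PV_subst _ (scons t Var) (r_addx0 rep).
rewrite /= !subst_olt !tsubst_oadd /= in mono.
rewrite /= tsubst_oadd /= (tsubst_closed _ _ (r_zero_below rep)) in add0.
have lt0 := LK_mp _ _ _ _ mono (r_lt01 rep).
set u := oadd c t (c_one c) in lt0 *.
(* The context for [LK_eq_subst]: variable 0 marks the place where $t+0$ is replaced by $t$. *)
pose A : fm := olt c (Var 0) (tshift u).
have instA v : inst A v = olt c v u.
  by rewrite /inst subst_olt /= /tshift tsubst_comp /= tsubst_Var.
apply: LK_cut1 lt0 _; rewrite -!instA.
apply: LK_cut1 (LK_theorem _ _ _ add0) _.
exact: LK_eq_subst.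
Qed.

Definition guarded (b : tm) (H : fm) : fm :=
  Or (Neg (olt c (Var 0) (tshift b))) H.

Lemma guarded_progressive (b : tm) (H : fm) :
  PV (ball c b (Imp (ball c (Var 0) (shift1 H))
                    (ball c (oadd c (Var 0) (c_one c)) (shift1 H)))) ->
  LK PV_rule ([:: ball c (Var 0) (shift1 (guarded b H))], [:: guarded b H]).
Proof.
(* Freeing the quantifier of the step makes its ordinal variable 0 coincide with the induction
   variable $\gamma$ of the goal. *)
move=> /PV_allE step; apply: LK_orNI.
set lt_b := olt c (Var 0) (tshift b); set IH := ball c _ _.
have H_below : LK PV_rule ([:: lt_b; IH], [:: ball c (Var 0) (shift1 H)]).
  (* Now variable 0 is some $\delta \prec \gamma$ and $\gamma$ has become [Var 1]. The guard $\delta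
     \prec \beta$ follows by transitivity through [Var 1]. *)
  apply: LK_allR; apply: LK_impR; rewrite /map; set lt01 := olt c _ _.
  have dIH : LK PV_rule ([:: lt01; shift lt_b; shift IH],
                         [:: Imp lt01 (shift1 (guarded b H))]).
    by apply: LK_shift_allE; right; right; left.
  apply: LK_orNE (LK_mp _ _ _ _ dIH _) _; first by apply: (@LK_In _ lt01); left.
  rewrite -[X in LK _ (_, [:: X])]/(shift1 (olt c (Var 0) (tshift b))) /shift1.
  rewrite subst_olt tsubst_up_tshift.
  apply: LK_mp (LK_mp _ _ _ _ (LK_theorem _ _ _ (PV_lt_trans _ (Var 1) _)) _) _.
    by apply: (@LK_In _ lt01); left.
  apply: (@LK_In _ (shift lt_b)); first by right; left.
  by rewrite /shift subst_olt; left.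
have lt_b_hyp : LK PV_rule ([:: lt_b; IH], [:: lt_b]).
  by apply: (@LK_In _ lt_b); left.
have H_succ := LK_mp _ _ _ _ (LK_mp _ _ _ _ (LK_theorem _ _ _ step) lt_b_hyp)
                 H_below.
(* The bounded statement below $\gamma+1$ is read at $\gamma$ itself, leaving $\gamma \prec \gamma+1
   \to H(\gamma)$. *)
move/(LK_inst _ _ (Var 0)): H_succ; rewrite /inst /=.
rewrite -[subst _ (shift1 H)]/(inst _ _) inst_shift1 subst_olt /=.
rewrite /tshift tsubst_comp /= tsubst_Var => H_succ.
by apply: LK_mp H_succ (LK_theorem _ _ _ (PV_lt_succ _)).
Qed.

Lemma forall1_subst (A : fm) s : forall1 A -> forall1 (subst s A).
Proof.
have qf_subst (B : fm) s' : qf B -> qf (subst s' B).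
  elim: B s' => //= B IHB C IHC s' [qfB qfC];
    by split; [apply: IHB | apply: IHC].
move=> allA; elim: allA s => /=.
- by move=> B qfB s; apply/forall1_qf/qf_subst.
- by move=> B C _ IHB _ IHC s; apply: forall1_and.
- by move=> B C _ IHB _ IHC s; apply: forall1_or.
- by move=> B _ IHB s; apply: forall1_all.
Qed.

Lemma forall1_guarded b H : forall1 H -> forall1 (guarded b H).
Proof.
move=> allH; apply: forall1_or => //.
(* The guard is a substitution instance of the quantifier-free formula [Neg (c_lt c)]. *)
rewrite -[Neg _]/(subst _ (Neg (c_lt c))); apply: forall1_subst.
by apply: forall1_qf; split=> //; apply: r_lt_qf rep.
Qed.

Lemma PV_TI S : LK PV_rule S -> TI c S.
Proof. by apply: LK_sub => ps q [A axA]; apply: TI_axiom. Qed.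

Lemma TI_progressive A :
  forall1 A -> LK PV_rule ([:: ball c (Var 0) (shift1 A)], [:: A]) ->
  TI c ([::], [:: A]).
Proof.
(* The rule concludes an instance of its formula, in which the parameters have
   moved down by one; shifting them up first makes this instance [A]. *)
move=> allA prog; rewrite -[A]inst_shift1.
apply: LK_rule; first by apply: TI_ind; apply: forall1_subst.
move=> p [<-|[]] /=; apply: PV_TI.
(* The premise for the shifted formula is [prog] under the renaming that fixes the eigenvariable and
   raises the parameters. *)
have := LK_PV_subst _ (up (fun i => Var i.+1)) prog.
by rewrite /= subst_olt subst_up_shift1.
Qed.

End Flow.

Theorem theorem4p9 (alpha : ordinal_type) (c : ordinal_code)
    (rep : PV_representation alpha c) (Gamma Delta : seq (form pvsym))
    (HGD : forall A : form pvsym, List.In A (Gamma ++ Delta) -> forall1 A)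
    (Hflow : exists (H : form pvsym) (beta : term pvsym),
        alpha_flow c (bigAnd Gamma) (bigOr Delta) H beta) :
  TI c (Gamma, Delta).
Proof.
case: Hflow => H [b flow].
have dH : TI c ([::], [:: guarded c b H]).
  apply: (TI_progressive _ _ rep).
    exact: (forall1_guarded _ _ rep _ _ (flow_H flow)).
  exact: (guarded_progressive _ _ rep _ _ (flow_step flow)).
have H_below : TI c ([::], [:: ball c b H]).
  (* The context is empty, so variable 0 in [dH] is arbitrary: generalizing it and assuming the
     guard gives back the bounded quantifier. *)
  apply: LK_allR; apply: LK_impR.
  apply: LK_orNE (LK_theorem _ _ _ dH) _.
  by apply: (@LK_In _ (olt c (Var 0) (tshift b))); left.
have dD : TI c ([::], [:: bigOr Delta]).
  exact: LK_mp (PV_TI _ _ (flow_end flow)) H_below.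
apply: (@LK_struct _ [::] Delta) => //.
(* Cutting on the disjunction separates it into the formulas of [Delta]. *)
apply: (LK_cut (A := bigOr Delta)).
  by apply: LK_struct dD => // A [<-|[]]; left.
exact: LK_bigOrL.
Qed.
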